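(* Let $\mathcal G$ be a (small) groupoid and let $\mathcal K=\{K_A\}_{A\in\mathcal G}$ be a family of groups indexed by the objects of $\mathcal G$. Then there is a bijection $$H^2_{|\mathsf{AUT}(\mathcal K)|}(\mathcal G,\mathcal K)\;\cong\;\mathrm{Ext}[\mathcal G,\mathcal K]$$ between the 2-dimensional cohomology set of $\mathcal G$ with coefficients in the 2-groupoid $\mathsf{AUT}(\mathcal K)$ (the set of cohomology classes of 2-cocycles) and the set of connected components of the category $\mathrm{Ext}(\mathcal G,\mathcal K)$ of extensions of $\mathcal G$ by $\mathcal K$.
   Context: Composition in a groupoid is written right to left: for $A\xrightarrow{u}B\xrightarrow{v}C$ the composite is $vu$. **Cocycles / weak actions.** $\mathsf{AUT}(\mathcal K)$ is the 2-groupoid whose objects are the groups $K_A$, whose 1-cells are the group isomorphisms between them, and whose 2-cells $f\to g$ (for $f,g:K_A\to K_B$) are the elements $\alpha\in K_B$ with $g(x)\alpha=\alpha f(x)$ for all $x\in K_A$. A 2-cocycle of $\mathcal G$ with coefficients in $\mathsf{AUT}(\mathcal K)$, also called a weak action of $\mathcal G$ on $\mathcal K$, is a normalized lax 2-functor $\mathcal G\to\mathsf{AUT}(\mathcal K)$ sending each object $A$ to $K_A$. Explicitly, it is a pair $(F,\sigma)$ where $F$ assigns to each arrow $u:A\to B$ of $\mathcal G$ a group isomorphism $F(u):K_A\to K_B$, and $\sigma$ assigns to each composable pair $A\xrightarrow{u}B\xrightarrow{v}C$ an element $\sigma_{vu}\in K_C$, such that for all 3-chains $A\xrightarrow{u}B\xrightarrow{v}C\xrightarrow{w}D$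 and $x\in K_A$: $F(1_A)(x)=x$; $\sigma_{1_A1_A}=1$; $\sigma_{vu}\,F(vu)(x)=F(v)(F(u)(x))\,\sigma_{vu}$; $\sigma_{wv}\,\sigma_{(wv)u}=F(w)(\sigma_{vu})\,\sigma_{w(vu)}$. A morphism $(F_1,\sigma^1)\to(F_2,\sigma^2)$ of weak actions is a family of maps of sets $\tau_{AB}:\mathcal G(A,B)\to K_B$ ($A,B$ objects of $\mathcal G$) such that for all $A\xrightarrow{u}B\xrightarrow{v}C$ in $\mathcal G$ and $k\in K_A$: $\tau_{AB}(u)\,F_1(u)(k)=F_2(u)(k)\,\tau_{AB}(u)$; $\tau_{AA}(1_A)=1$; $F_2(v)(\tau_{AB}(u))\,\tau_{BC}(v)\,\sigma^1_{vu}=\sigma^2_{vu}\,\tau_{AC}(vu)$. Composition is by pointwise product, $(\tau'\tau)_{AB}(u)=\tau'_{AB}(u)\tau_{AB}(u)$ for $\tau:F_1\to F_2$, $\tau':F_2\to F_3$. This gives the category $\widetilde{\mathsf{Act}}(\mathcal G,\mathcal K)$. Two 2-cocycles are cohomologous if there is a morphism between them. **Cohomology.** $H^2_{|\mathsf{AUT}(\mathcal K)|}(\mathcal G,\mathcal K)$ is by definition the set of connected components of the category $\widetilde{\mathsf{Act}}(\mathcal G,\mathcal K)$. **Extensions.** A functor between groupoids $P:\mathcal E\to\mathcal G$ is a fibration if for every object $E$ of $\mathcal E$ and every arrow $f:P(E)\to B$ in $\mathcal G$ there is an arrow $\tilde f$ in $\mathcal E$ with domain $E$ and $P(\tilde f)=f$.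 The fiber of $P$ over an object $A$ is the subcategory of $\mathcal E$ of objects mapped to $A$ and arrows mapped to $1_A$. An extension of $\mathcal G$ by $\mathcal K$ is a fibration of groupoids $P:\mathcal E\to\mathcal G$, bijective on objects, whose fiber over each object $A$ is (identified with) the group $K_A$; equivalently, regarding $\mathcal K$ as a totally disconnected groupoid, a short exact sequence of groupoids $1\to\mathcal K\to\mathcal E\xrightarrow{P}\mathcal G\to1$. Morphisms in $\mathrm{Ext}(\mathcal G,\mathcal K)$ are the functors $\mathcal E\to\mathcal E'$ over $\mathcal G$ inducing the identity on fibers (i.e. commuting with the inclusions of $\mathcal K$ and the projections to $\mathcal G$). $\mathrm{Ext}[\mathcal G,\mathcal K]$ is the set of connected components of this category. *)

(* Defs.v *)
From mathcomp Require Import all_boot.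
From mathcomp Require Import boolp.
From Stdlib Require Import Relations.

Set Implicit Arguments.
Unset Strict Implicit.
Unset Printing Implicit Defensive.

Local Open Scope group_scope.

(** * Categories and connected components *)

Record category := Category {
  cobj :> Type;
  chom : cobj -> cobj -> Type;
  cid : forall X, chom X X;
  ccomp : forall X Y Z, chom Y Z -> chom X Y -> chom X Z;
  ccompA : forall X Y Z T (h : chom Z T) (g : chom Y Z) (f : chom X Y),
    ccomp h (ccomp g f) = ccomp (ccomp h g) f;
  ccomp1l : forall X Y (f : chom X Y), ccomp (cid Y) f = f;
  ccomp1r : forall X Y (f : chom X Y), ccomp f (cid X) = f }.

Definition connected (C : category) : C -> C -> Prop :=
  clos_refl_sym_trans C (fun X Y => inhabited (chom X Y)).

(* The quotient by [connected], as the set of equivalence classes. *)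
Definition connected_components (C : category) : Type :=
  {S : C -> Prop | exists X : C, S = connected X}.

(** * Groupoids *)

(* Kept apart from [category] for universe reasons: the groupoids (small) are
   part of the objects of a category of extensions (large). *)
Record groupoid := Groupoid {
  gobj :> Type;
  ghom : gobj -> gobj -> Type;
  gid : forall A, ghom A A;
  gcomp : forall A B C, ghom B C -> ghom A B -> ghom A C;
  ginv : forall A B, ghom A B -> ghom B A;
  gcompA : forall A B C D (w : ghom C D) (v : ghom B C) (u : ghom A B),
    gcomp w (gcomp v u) = gcomp (gcomp w v) u;
  gcomp1l : forall A B (u : ghom A B), gcomp (gid B) u = u;
  gcomp1r : forall A B (u : ghom A B), gcomp u (gid A) = u;
  gcompVl : forall A B (u : ghom A B), gcomp (ginv u) u = gid A;
  gcompVr : forall A B (u : ghom A B), gcomp u (ginv u) = gid B }.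

Arguments gid {g} A.

Notation "v \og u" := (gcomp v u) (at level 40, left associativity).

(* Equality of arrows whose end points are not syntactically the same. *)
Inductive hom_eq (G : groupoid) (A B : G) (u : ghom A B) :
    forall A' B' : G, ghom A' B' -> Prop :=
  hom_eq_refl : hom_eq u u.

Lemma hom_eq_cast (G : groupoid) (A B A' B' : G) (u : ghom A B)
    (v : ghom A' B') (eA : A' = A) (eB : B' = B) :
  hom_eq u v -> eq_rect B' (fun Y => ghom A Y) (eq_rect A' (fun X => ghom X B') v A eA) B eB = u.
Proof.
move=> e; case: e eA eB => eA eB.
by rewrite (Prop_irrelevance eA erefl) (Prop_irrelevance eB erefl).
Qed.

Lemma hom_eqP (G : groupoid) (A B : G) (u v : ghom A B) :
  hom_eq u v <-> u = v.
Proof. by split=> [/(hom_eq_cast erefl erefl)|->]. Qed.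

Record functor (G H : groupoid) := Functor {
  fobj :> G -> H;
  fhom : forall A B, ghom A B -> ghom (fobj A) (fobj B);
  fhom1 : forall A, fhom (gid A) = gid (fobj A);
  fhomM : forall A B C (v : ghom B C) (u : ghom A B),
    fhom (v \og u) = fhom v \og fhom u }.

Definition functor_id (G : groupoid) : functor G G :=
  @Functor G G id (fun _ _ u => u) (fun _ => erefl) (fun _ _ _ _ _ => erefl).

Section FunctorComp.
Variables (G H L : groupoid) (Q : functor H L) (P : functor G H).

Lemma functor_comp1 A : fhom Q (fhom P (gid A)) = gid (Q (P A)).
Proof. by rewrite !fhom1. Qed.

Lemma functor_compM A B C (v : ghom B C) (u : ghom A B) :
  fhom Q (fhom P (v \og u)) = fhom Q (fhom P v) \og fhom Q (fhom P u).
Proof. by rewrite !fhomM. Qed.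

Definition functor_comp : functor G L :=
  @Functor G L (Q \o P) (fun _ _ u => fhom Q (fhom P u))
    functor_comp1 functor_compM.
End FunctorComp.

Lemma functor_irr (G H : groupoid) (o : G -> H)
    (h : forall A B, ghom A B -> ghom (o A) (o B)) p1 p2 q1 q2 :
  @Functor G H o h p1 p2 = @Functor G H o h q1 q2.
Proof. by rewrite (Prop_irrelevance p1 q1) (Prop_irrelevance p2 q2). Qed.

Lemma functor_compA (G H L M : groupoid)
    (R : functor L M) (Q : functor H L) (P : functor G H) :
  functor_comp R (functor_comp Q P) = functor_comp (functor_comp R Q) P.
Proof. exact: functor_irr. Qed.

Lemma functor_comp1l (G H : groupoid) (P : functor G H) :
  functor_comp (functor_id H) P = P.
Proof. by case: P => o h p1 p2; exact: functor_irr. Qed.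

Lemma functor_comp1r (G H : groupoid) (P : functor G H) :
  functor_comp P (functor_id G) = P.
Proof. by case: P => o h p1 p2; exact: functor_irr. Qed.

Definition iso_functor (G H : groupoid) (P : functor G H) : Prop :=
  exists Q : functor H G,
    functor_comp Q P = functor_id G /\ functor_comp P Q = functor_id H.

Definition fibration (E G : groupoid) (P : functor E G) : Prop :=
  forall (X : E) (B : G) (u : ghom (P X) B),
    exists (Y : E) (t : ghom X Y), hom_eq (fhom P t) u.

Section Fiber.
Variables (E G : groupoid) (P : functor E G) (A : G).

Definition fiber_obj := {X : E | P X = A}.

Definition fiber_hom (X Y : fiber_obj) :=
  {t : ghom (sval X) (sval Y) | hom_eq (fhom P t) (gid A)}.

Lemma fiber_id_subproof (X : fiber_obj) :
  hom_eq (fhom P (gid (sval X))) (gid A).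
Proof. by case: X => X /= <-; rewrite fhom1. Qed.

Definition fiber_id (X : fiber_obj) : fiber_hom X X :=
  exist _ (gid (sval X)) (fiber_id_subproof X).

Lemma fiber_comp_subproof (X Y Z : fiber_obj)
    (t : fiber_hom Y Z) (s : fiber_hom X Y) :
  hom_eq (fhom P (sval t \og sval s)) (gid A).
Proof.
case: X Y Z t s => [X eX] [Y eY] [Z eZ] [/= t et] [/= s es].
rewrite fhomM; move: (fhom P t) (fhom P s) et es => {}t {}s.
move: t s; rewrite eX eY eZ => t s /hom_eqP -> /hom_eqP ->.
by rewrite gcomp1l.
Qed.

Definition fiber_comp (X Y Z : fiber_obj)
    (t : fiber_hom Y Z) (s : fiber_hom X Y) : fiber_hom X Z :=
  exist _ (sval t \og sval s) (fiber_comp_subproof t s).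

Lemma fiber_inv_subproof (X Y : fiber_obj) (t : fiber_hom X Y) :
  hom_eq (fhom P (ginv (sval t))) (gid A).
Proof.
case: X Y t => [X eX] [Y eY] [/= t et].
have := fhomM P (ginv t) t; rewrite gcompVl fhom1.
move: (fhom P t) (fhom P (ginv t)) et => {}t s.
move: t s; rewrite eX eY => t s /hom_eqP ->.
by rewrite gcomp1r => ->.
Qed.

Definition fiber_inv (X Y : fiber_obj) (t : fiber_hom X Y) : fiber_hom Y X :=
  exist _ (ginv (sval t)) (fiber_inv_subproof t).

Lemma fiber_hom_inj (X Y : fiber_obj) (s t : fiber_hom X Y) :
  sval s = sval t -> s = t.
Proof. by move=> st; apply: eq_sig_hprop => // ? ? ?; exact: Prop_irrelevance. Qed.

Definition fiber : groupoid.
Proof.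
refine (@Groupoid fiber_obj fiber_hom fiber_id fiber_comp fiber_inv _ _ _ _ _);
  move=> *; apply: fiber_hom_inj.
- exact: gcompA.
- exact: gcomp1l.
- exact: gcomp1r.
- exact: gcompVl.
- exact: gcompVr.
Defined.

Definition fiber_incl : functor fiber E :=
  @Functor fiber E (fun X => sval X) (fun _ _ t => sval t)
    (fun _ => erefl) (fun _ _ _ _ _ => erefl).
End Fiber.

(* A group as a groupoid with one object. *)
Definition delooping (K : groupType) : groupoid :=
  @Groupoid unit (fun _ _ => K) (fun _ => 1) (fun _ _ _ y x => y * x)
    (fun _ _ x => x^-1)
    (fun _ _ _ _ z y x => mulgA z y x) (fun _ _ x => mul1g x)
    (fun _ _ x => mulg1 x) (fun _ _ x => mulVg x) (fun _ _ x => mulgV x).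

(** * Weak actions *)

Section WeakActions.
Variables (G : groupoid) (K : G -> groupType).

(* A normalized lax 2-functor from [G] to the 2-groupoid AUT(K), i.e. a
   2-cocycle: [wact u] is F(u) and [wcoc v u] is sigma_{vu}, for u : A -> B and
   v : B -> C.  A [groupType] carries a choice structure; under the classical
   axioms every group has one, and morphisms ignore it. *)
Record weak_action := WeakAction {
  wact : forall A B : G, ghom A B -> {multiplicative K A -> K B};
  wact_bij : forall (A B : G) (u : ghom A B), bijective (wact u);
  wcoc : forall A B C : G, ghom B C -> ghom A B -> K C;
  wact1 : forall (A : G) (x : K A), wact (gid A) x = x;
  wcoc1 : forall A : G, wcoc (gid A) (gid A) = 1;
  wactM : forall (A B C : G) (v : ghom B C) (u : ghom A B) (x : K A),
    wcoc v u * wact (v \og u) x = wact v (wact u x) * wcoc v u;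
  wcocA : forall (A B C D : G)
      (w : ghom C D) (v : ghom B C) (u : ghom A B),
    wcoc w v * wcoc (w \og v) u = wact w (wcoc v u) * wcoc w (v \og u) }.

Record weak_action_hom (F1 F2 : weak_action) := WeakActionHom {
  wtr : forall A B : G, ghom A B -> K B;
  wtr_act : forall (A B : G) (u : ghom A B) (k : K A),
    wtr u * wact F1 u k = wact F2 u k * wtr u;
  wtr1 : forall A : G, wtr (gid A) = 1;
  wtr_coc : forall (A B C : G) (v : ghom B C) (u : ghom A B),
    wact F2 v (wtr u) * wtr v * wcoc F1 v u = wcoc F2 v u * wtr (v \og u) }.

Lemma weak_action_hom_eq (F1 F2 : weak_action) (s t : weak_action_hom F1 F2) :
  (forall A B (u : ghom A B), wtr s u = wtr t u) -> s = t.
Proof.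
case: s t => [s s1 s2 s3] [t t1 t2 t3] /= st.
have {}st : s = t.
  by apply: functional_extensionality_dep => A;
     apply: functional_extensionality_dep => B; apply/funext => u; exact: st.
case: _ / st in t1 t2 t3 *.
by rewrite (Prop_irrelevance s1 t1) (Prop_irrelevance s2 t2)
  (Prop_irrelevance s3 t3).
Qed.

Lemma wact_one (F : weak_action) (A B : G) (u : ghom A B) : wact F u 1 = 1.
Proof. by apply: (mulgI (wact F u 1)); rewrite -gmulfM !mulg1. Qed.

Definition weak_action_id (F : weak_action) : weak_action_hom F F.
Proof.
refine (@WeakActionHom F F (fun _ _ _ => 1) _ _ _) => //.
- by move=> *; rewrite mul1g mulg1.
- by move=> *; rewrite wact_one !mul1g mulg1.
Defined.

Definition weak_action_comp (F1 F2 F3 : weak_action)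
  (t' : weak_action_hom F2 F3) (t : weak_action_hom F1 F2) :
  weak_action_hom F1 F3.
Proof.
refine (@WeakActionHom F1 F3 (fun _ _ u => wtr t' u * wtr t u) _ _ _).
- by move=> A B u k; rewrite -mulgA wtr_act mulgA wtr_act mulgA.
- by move=> A; rewrite !wtr1 mulg1.
- move=> A B C v u; rewrite gmulfM [RHS]mulgA -wtr_coc -!mulgA; congr (_ * _).
  by rewrite -wtr_coc !mulgA wtr_act.
Defined.

Definition Act : category.
Proof.
refine (@Category weak_action weak_action_hom weak_action_id weak_action_comp
  _ _ _); move=> *; apply: weak_action_hom_eq => A B u /=.
- exact: mulgA.
- exact: mul1g.
- exact: mulg1.
Defined.

Definition H2_AUT : Type := connected_components Act.

End WeakActions.

(** * Extensions *)

Section Extensions.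
Variables (G : groupoid) (K : G -> groupType).

(* The identification of the fiber over [A] with the group [K A] is the data of
   an isomorphism of groupoids from the one-object groupoid of [K A]. *)
Record extension := Extension {
  ext_groupoid : groupoid;
  ext_proj : functor ext_groupoid G;
  ext_fibration : fibration ext_proj;
  ext_bij_obj : bijective (fobj ext_proj);
  ext_fiber : forall A : G, functor (delooping (K A)) (fiber ext_proj A);
  ext_fiber_iso : forall A : G, iso_functor (ext_fiber A) }.

Definition ext_incl (E : extension) (A : G) :
    functor (delooping (K A)) (ext_groupoid E) :=
  functor_comp (fiber_incl (ext_proj E) A) (ext_fiber E A).

Record extension_hom (E E' : extension) := ExtensionHom {
  ehom :> functor (ext_groupoid E) (ext_groupoid E');
  ehom_proj : functor_comp (ext_proj E') ehom = ext_proj E;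
  ehom_incl : forall A : G, functor_comp ehom (ext_incl E A) = ext_incl E' A }.

Lemma extension_hom_eq (E E' : extension) (f g : extension_hom E E') :
  ehom f = ehom g -> f = g.
Proof.
case: f g => [f f1 f2] [g g1 g2] /= fg; case: _ / fg in g1 g2 *.
by rewrite (Prop_irrelevance f1 g1) (Prop_irrelevance f2 g2).
Qed.

Definition extension_id (E : extension) : extension_hom E E :=
  @ExtensionHom E E (functor_id _) (functor_comp1r _)
    (fun A => functor_comp1l _).

Definition extension_comp (E1 E2 E3 : extension)
  (g : extension_hom E2 E3) (f : extension_hom E1 E2) : extension_hom E1 E3.
Proof.
refine (@ExtensionHom E1 E3 (functor_comp g f) _ _).
- by rewrite functor_compA !ehom_proj.
- by move=> A; rewrite -functor_compA !ehom_incl.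
Defined.

Definition Ext : category.
Proof.
refine (@Category extension extension_hom extension_id extension_comp _ _ _);
  move=> *; apply: extension_hom_eq.
- exact: functor_compA.
- exact: functor_comp1l.
- exact: functor_comp1r.
Defined.

Definition Ext_components : Type := connected_components Ext.

End Extensions.

(* Main.v *)
Require Import Defs.
From mathcomp Require Import all_boot.
From mathcomp Require Import boolp.
From HB Require Import structures.
From Stdlib Require Import Relations.

(** This is Schreier's classification of group extensions, carried out over a
groupoid.  A weak action (F, sigma) of G on K gives the crossed product
[cross]: the arrows A -> B are the pairs (k, u) with k in K_B and u : A -> B,
read as formal products k s(u), and they are multiplied by the rules
s(u) x = F(u)(x) s(u) and s(v) s(u) = sigma_{vu} s(vu).  The
associativity of this product amounts to the axioms [wactM] and [wcocA] of weak
actions, and the bijection sends the class of F to the component of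
[cross F].

The bridge between the two categories is the notion of a weak action F
presenting an extension E ([presents F E]): some section u |-> s(u) of the
projection of E obeys the two multiplication rules of F.  Four facts about it
carry the proof.

- It is the same as having a morphism from the crossed product of F to E
  ([presents_hom] and [presents_of_hom]); in particular it is transported along
  morphisms of extensions.
- Every extension is presented by some weak action ([presents_ex]): choose a section
  and read F off conjugation by s(u), and sigma off the failure of s to be a
  functor.
- Two weak actions presenting the same extension are cohomologous
  ([presents_cohomologous]): two sections s and s' differ by elements
  tau(u) of K, with s'(u) = tau(u) s(u), and tau is a morphism.
- If tau is a morphism from F to F', then F presents the crossed product of
  F', via the section tau(u)^-1 s(u) ([presents_pushforward]).

By the first and last facts cohomologous weak actions have connected crossed
products; by the first three, weak actions presenting connected extensions
are cohomologous ([presents_connected]), which gives injectivity; by the first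
two every extension is connected to a crossed product.

Objects of an extension lie over those of G only up to a propositional
equality.  The extension is therefore worked with at the base points [ext_base],
the image of the unique object of the group K_A, which every morphism of
extensions preserves; arrows that lie over the base points or over G up to such
equalities are compared by [hom_eq]. *)

Set Implicit Arguments.
Unset Strict Implicit.
Unset Printing Implicit Defensive.

Local Open Scope group_scope.

(** * Arrows with propositionally equal end points *)

Section HomEq.
Variable G : groupoid.

Lemma hom_eq_ends (A B A' B' : G) (u : ghom A B) (v : ghom A' B') :
  hom_eq u v -> A = A' /\ B = B'.
Proof. by case. Qed.

Lemma hom_eq_sym (A B A' B' : G) (u : ghom A B) (v : ghom A' B') :
  hom_eq u v -> hom_eq v u.
Proof. by case. Qed.

Lemma hom_eq_trans (A B A' B' A'' B'' : G) (u : ghom A B) (v : ghom A' B')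
    (w : ghom A'' B'') :
  hom_eq u v -> hom_eq v w -> hom_eq u w.
Proof. by case. Qed.

Lemma hom_eq_gid (A B : G) : A = B -> hom_eq (gid A) (gid B).
Proof. by move->. Qed.

Lemma hom_eq_cast_ex (A B A' B' : G) (u : ghom A B) :
  A = A' -> B = B' -> exists v : ghom A' B', hom_eq u v.
Proof. by move=> <- <-; exists u. Qed.

Lemma hom_eq_comp (A B C A' B' C' : G) (v : ghom B C) (u : ghom A B)
    (v' : ghom B' C') (u' : ghom A' B') :
  hom_eq v v' -> hom_eq u u' -> hom_eq (v \og u) (v' \og u').
Proof.
move=> ev eu; have [eB eC] := hom_eq_ends ev; have [eA _] := hom_eq_ends eu.
move: v' u' ev eu; rewrite -eA -eB -eC => v' u' /hom_eqP -> /hom_eqP ->.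
by [].
Qed.

Lemma hom_eq_inv (A B A' B' : G) (u : ghom A B) (v : ghom A' B') :
  hom_eq u v -> hom_eq (ginv u) (ginv v).
Proof. by case. Qed.

Lemma gcompK (A B C : G) (u : ghom A B) (v : ghom B C) :
  v \og u \og ginv u = v.
Proof. by rewrite -gcompA gcompVr gcomp1r. Qed.

Lemma gcompVK (A B C : G) (u : ghom A B) (v : ghom A C) :
  v \og ginv u \og u = v.
Proof. by rewrite -gcompA gcompVl gcomp1r. Qed.

Lemma gcompKV (A B C : G) (u : ghom A B) (v : ghom B C) :
  ginv v \og (v \og u) = u.
Proof. by rewrite gcompA gcompVl gcomp1l. Qed.

Lemma gcompVVK (A B C : G) (u : ghom A C) (v : ghom B C) :
  v \og (ginv v \og u) = u.
Proof. by rewrite gcompA gcompVr gcomp1l. Qed.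

Lemma gcompI (A B C : G) (u v : ghom A B) (w : ghom B C) :
  w \og u = w \og v -> u = v.
Proof. by move=> /(congr1 (fun t => ginv w \og t)); rewrite !gcompKV. Qed.

Lemma gcompIr (A B C : G) (u v : ghom B C) (w : ghom A B) :
  u \og w = v \og w -> u = v.
Proof. by move=> /(congr1 (fun t => t \og ginv w)); rewrite !gcompK. Qed.

End HomEq.

Section Functors.
Variables G H : groupoid.

Lemma fhomV (P : functor G H) (A B : G) (u : ghom A B) :
  fhom P (ginv u) = ginv (fhom P u).
Proof. by apply: (@gcompI _ _ _ _ _ _ (fhom P u)); rewrite -fhomM !gcompVr fhom1. Qed.

Lemma hom_eq_fhom (P : functor G H) (A B A' B' : G) (u : ghom A B)
    (v : ghom A' B') :
  hom_eq u v -> hom_eq (fhom P u) (fhom P v).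
Proof. by case. Qed.

Lemma hom_eq_functor (P Q : functor G H) :
  P = Q -> forall (A B : G) (u : ghom A B), hom_eq (fhom P u) (fhom Q u).
Proof. by move->. Qed.

(** Since [hom_eq] determines end points, its instances at the identities give the
equality of the maps on objects. *)
Lemma functor_ext (P Q : functor G H) :
  (forall (A B : G) (u : ghom A B), hom_eq (fhom P u) (fhom Q u)) -> P = Q.
Proof.
case: P Q => [o h p1 p2] [o' h' q1 q2] /= e.
have eo : o = o' by apply/funext => A; have [] := hom_eq_ends (e A A (gid A)).
case: _ / eo in h' q1 q2 e *.
have eh : h = h'.
  apply: functional_extensionality_dep => A.
  apply: functional_extensionality_dep => B.
  by apply/funext => u; apply/hom_eqP.
case: _ / eh in q1 q2 *.
exact: functor_irr.
Qed.

End Functors.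

Section Retraction.
Variables G H : groupoid.

Lemma functor_compK (P : functor G H) (Q : functor H G) :
  functor_comp Q P = functor_id G ->
  forall (A B : G) (u : ghom A B), hom_eq (fhom Q (fhom P u)) u.
Proof. by move=> QP A B u; exact: hom_eq_functor QP _ _ u. Qed.

End Retraction.

Section IsoFunctors.
Variables (G H : groupoid) (P : functor G H) (A B : G).
Hypothesis isoP : iso_functor P.

Lemma iso_functor_faithful : injective (@fhom _ _ P A B).
Proof.
have [Q [eQP _]] := isoP; have QP := functor_compK eQP => u v e.
have := QP _ _ u; rewrite e => /hom_eq_sym euv; apply/hom_eqP.
exact: hom_eq_trans euv (QP _ _ v).
Qed.

Lemma iso_functor_full (t : ghom (P A) (P B)) :
  exists u : ghom A B, fhom P u = t.
Proof.
have [Q [eQP ePQ]] := isoP.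
have QP := functor_compK eQP; have PQ := functor_compK ePQ.
have QPo X : Q (P X) = X by have [] := hom_eq_ends (QP _ _ (gid X)).
have [u ue] := hom_eq_cast_ex (fhom Q t) (QPo A) (QPo B).
exists u; apply/hom_eqP.
exact: hom_eq_trans (hom_eq_fhom P (hom_eq_sym ue)) (PQ _ _ t).
Qed.

End IsoFunctors.

(** * The crossed product of a weak action *)

Section CrossedProduct.
Variables (G : groupoid) (K : G -> groupType) (F : weak_action K).

Lemma wactV (A B : G) (u : ghom A B) (x : K A) :
  wact F u x^-1 = (wact F u x)^-1.
Proof. by apply: (mulgI (wact F u x)); rewrite -gmulfM !mulgV wact_one. Qed.

(** The cocycle condition at a chain with two identities turns the normalization
at pairs of identities into normalization on each side. *)
Lemma wcoc1l (A B : G) (u : ghom A B) : wcoc F (gid B) u = 1.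
Proof.
have := wcocA F (gid B) (gid B) u.
by rewrite !gcomp1l wcoc1 wact1 => /mulIg ->.
Qed.

Lemma wcoc1r (A B : G) (u : ghom A B) : wcoc F u (gid A) = 1.
Proof.
have := wcocA F u (gid A) (gid A).
by rewrite gcomp1r gcomp1l wcoc1 wact_one mul1g => /(canRL (mulgK _)); rewrite mulgV.
Qed.

Definition cross_hom (A B : G) : Type := (K B * ghom A B)%type.

Definition cross_id (A : G) : cross_hom A A := (1, gid A).

Definition cross_comp (A B C : G) (y : cross_hom B C) (x : cross_hom A B) :
    cross_hom A C :=
  (y.1 * wact F y.2 x.1 * wcoc F y.2 x.2, y.2 \og x.2).

(** The first component is forced by the left inverse law; that it is also a
right inverse uses the cocycle condition at u, u^-1, u. *)
Definition cross_inv (A B : G) (x : cross_hom A B) : cross_hom B A :=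
  ((wact F (ginv x.2) x.1 * wcoc F (ginv x.2) x.2)^-1, ginv x.2).

Definition cross_product : groupoid.
Proof.
refine (@Groupoid G cross_hom cross_id cross_comp cross_inv _ _ _ _ _).
- move=> A B C D [m w] [l v] [k u]; congr pair => /=; last exact: gcompA.
  rewrite !gmulfM -!mulgA; congr (_ * (_ * _)).
  by rewrite -wcocA !mulgA wactM.
- by move=> A B [k u]; rewrite /cross_comp /= wact1 wcoc1l gcomp1l mul1g mulg1.
- by move=> A B [k u]; rewrite /cross_comp /= wact_one wcoc1r gcomp1r !mulg1.
- move=> A B [k u]; rewrite /cross_comp /cross_inv /=.
  by rewrite -mulgA mulVg gcompVl.
- move=> A B [k u]; rewrite /cross_comp /cross_inv /= gcompVr; congr pair.
  have e : wact F u (wcoc F (ginv u) u) = wcoc F u (ginv u).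
    have := wcocA F u (ginv u) u.
    by rewrite gcompVl gcompVr wcoc1l wcoc1r !mulg1.
  by rewrite wactV gmulfM e -wactM gcompVr wact1 invgM mulgA mulgV mul1g mulVg.
Defined.

Definition cross_proj : functor cross_product G :=
  @Functor cross_product G id (fun _ _ x => x.2) (fun _ => erefl)
    (fun _ _ _ _ _ => erefl).

Lemma cross_fibration : fibration cross_proj.
Proof. by move=> A B u; exists B, (1, u). Qed.

Lemma cross_bij_obj : bijective (fobj cross_proj).
Proof. by exists id. Qed.

Definition cross_fiber_obj (A : G) : fiber cross_proj A :=
  exist (fun X : cross_product => cross_proj X = A) A erefl.

Definition cross_fiber_hom (A : G) (k : K A) :
    ghom (cross_fiber_obj A) (cross_fiber_obj A) :=
  exist (fun t : @ghom cross_product A A => hom_eq (fhom cross_proj t) (gid A))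
    (k, gid A) (hom_eq_refl (gid A)).

Definition cross_fiber (A : G) :
  functor (delooping (K A)) (fiber cross_proj A).
Proof.
refine (@Functor (delooping (K A)) (fiber cross_proj A)
  (fun _ => cross_fiber_obj A) (fun _ _ k => cross_fiber_hom k) _ _).
- by move=> ?; exact: fiber_hom_inj.
- move=> ? ? ? l k; apply: fiber_hom_inj.
  by rewrite /= /cross_comp /= wact1 wcoc1 gcomp1l mulg1.
Defined.

(** An arrow of the fiber over A is a pair whose first component lies in the
group of its target, an object only propositionally equal to A. *)
Definition cross_fiber_inv_hom (A : G) (X Y : fiber cross_proj A)
    (t : ghom X Y) : K A :=
  eq_rect (sval Y) K (sval t).1 A (proj2_sig Y).

Definition cross_fiber_inv (A : G) :
  functor (fiber cross_proj A) (delooping (K A)).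
Proof.
refine (@Functor (fiber cross_proj A) (delooping (K A))
  (fun _ => tt) (@cross_fiber_inv_hom A) _ _).
- by move=> [X e]; rewrite /cross_fiber_inv_hom /=; case: A / e.
- move=> [X eX] [Y eY] [Z eZ] [[l v] ev] [[k u] eu].
  rewrite /cross_fiber_inv_hom; simpl in *; subst X Y Z.
  by move/hom_eqP: ev => /= ->; move/hom_eqP: eu => /= ->; rewrite wact1 wcoc1 mulg1.
Defined.

Lemma cross_fiber_iso (A : G) : iso_functor (cross_fiber A).
Proof.
exists (cross_fiber_inv A); split; apply: functor_ext.
- by move=> [] [] k.
- move=> [X eX] [Y eY] [[k u] e]; simpl in *; subst X Y.
  by apply/hom_eqP; apply: fiber_hom_inj; congr pair; apply: esym; apply/hom_eqP.
Qed.

Definition cross : extension K :=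
  Extension cross_fibration cross_bij_obj cross_fiber_iso.

End CrossedProduct.

(** * Base points and kernel of an extension *)

Section Kernel.
Variables (G : groupoid) (K : G -> groupType) (E : extension K).

Definition ext_base (A : G) : ext_groupoid E := ext_incl E A tt.

Definition ext_ker (A : G) (k : K A) : ghom (ext_base A) (ext_base A) :=
  @fhom _ _ (ext_incl E A) tt tt k.

Lemma ext_proj_base (A : G) : ext_proj E (ext_base A) = A.
Proof. exact: (proj2_sig (ext_fiber E A tt)). Qed.

Lemma ext_base_proj (X : ext_groupoid E) : ext_base (ext_proj E X) = X.
Proof. exact: (bij_inj (ext_bij_obj E) (ext_proj_base _)). Qed.

Lemma ext_kerM (A : G) (l k : K A) :
  ext_ker (l * k) = ext_ker l \og ext_ker k.
Proof. exact: (@fhomM _ _ (ext_incl E A) tt tt tt). Qed.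

Lemma ext_ker1 (A : G) : ext_ker (1 : K A) = gid (ext_base A).
Proof. exact: (@fhom1 _ _ (ext_incl E A) tt). Qed.

Lemma ext_proj_ker (A : G) (k : K A) : hom_eq (fhom (ext_proj E) (ext_ker k)) (gid A).
Proof. exact: (proj2_sig (@fhom _ _ (ext_fiber E A) tt tt k)). Qed.

Lemma ext_ker_inj (A : G) : injective (@ext_ker A).
Proof.
have inj := @iso_functor_faithful _ _ (ext_fiber E A) tt tt (ext_fiber_iso E A).
by move=> k l kl; apply: (inj k l); exact: fiber_hom_inj.
Qed.

Lemma ext_ker_surj (A : G) (t : ghom (ext_base A) (ext_base A)) :
  hom_eq (fhom (ext_proj E) t) (gid A) -> exists k, ext_ker k = t.
Proof.
move=> et; pose X := ext_fiber E A tt.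
have [k ek] := @iso_functor_full _ _ (ext_fiber E A) tt tt (ext_fiber_iso E A)
  (exist _ t et : fiber_hom X X).
by exists k; rewrite /ext_ker /= ek.
Qed.

(** Exactness in the form used below: the arrows of E over a given u form a
torsor under the kernel.  Uniqueness of the kernel element is
[ext_ker_cancel]. *)
Lemma ext_ker_torsor (A B : G) (u : ghom A B)
    (t t' : ghom (ext_base A) (ext_base B)) :
  hom_eq (fhom (ext_proj E) t) u -> hom_eq (fhom (ext_proj E) t') u ->
  exists k, t' = ext_ker k \og t.
Proof.
move=> et et'; have [|k ek] := @ext_ker_surj B (t' \og ginv t).
  by rewrite fhomM fhomV -(gcompVr u); apply: hom_eq_comp; last exact: hom_eq_inv.
by exists k; rewrite ek gcompVK.
Qed.

Lemma ext_ker_cancel (A B : G) (t : ghom (ext_base A) (ext_base B)) (k l : K B) :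
  ext_ker k \og t = ext_ker l \og t -> k = l.
Proof. by move/gcompIr/ext_ker_inj. Qed.

End Kernel.

(** * Weak actions presented by an extension *)

Section Presentation.
Variables (G : groupoid) (K : G -> groupType).

(** Normalization of the section is a consequence of [psecM], see [psec1]. *)
Record presents (F : weak_action K) (E : extension K) := Presents {
  psec : forall A B : G, ghom A B -> ghom (ext_base E A) (ext_base E B);
  psec_proj : forall (A B : G) (u : ghom A B),
    hom_eq (fhom (ext_proj E) (psec u)) u;
  psec_act : forall (A B : G) (u : ghom A B) (x : K A),
    psec u \og ext_ker E x = ext_ker E (wact F u x) \og psec u;
  psecM : forall (A B C : G) (v : ghom B C) (u : ghom A B),
    psec v \og psec u = ext_ker E (wcoc F v u) \og psec (v \og u) }.

(** The square of s(1) is sigma_{11} s(1) = s(1), and arrows are invertible. *)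
Lemma psec1 (F : weak_action K) (E : extension K) (s : presents F E) (A : G) :
  psec s (gid A) = gid (ext_base E A).
Proof.
apply: (@gcompI _ _ _ _ _ _ (psec s (gid A))).
by rewrite psecM wcoc1 ext_ker1 gcomp1l !gcomp1r.
Qed.

Section ToHom.
Variables (F : weak_action K) (E : extension K) (s : presents F E).

(** The formal product k s(u) is evaluated in E; the rules obeyed by the section
say that this respects composition. *)
Definition presents_functor : functor (cross_product F) (ext_groupoid E).
Proof.
refine (@Functor (cross_product F) (ext_groupoid E) (ext_base E)
  (fun A B x => ext_ker E x.1 \og psec s x.2) _ _).
- by move=> A /=; rewrite ext_ker1 psec1 gcomp1l.
- move=> A B C [l v] [k u] /=; rewrite !ext_kerM -!gcompA; congr (_ \og _).
  by rewrite -psecM !gcompA psec_act.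
Defined.

Definition presents_hom : extension_hom (cross F) E.
Proof.
refine (@ExtensionHom _ _ (cross F) E presents_functor _ _).
- apply: functor_ext => A B [k u] /=; rewrite fhomM.
  rewrite -[X in hom_eq _ X]gcomp1l.
  by apply: hom_eq_comp (ext_proj_ker _ _) (psec_proj _ _).
- move=> A; apply: functor_ext => -[] [] k /=.
  by rewrite psec1 gcomp1r.
Defined.
End ToHom.

(** A morphism carries the tautological section u |-> (1, u) of the crossed
product to a section of E obeying the same rules.  The image has end points
equal to the base points of E because the morphism commutes with the inclusions
of the groups. *)
Lemma presents_of_hom (F : weak_action K) (E : extension K) :
  extension_hom (cross F) E -> inhabited (presents F E).
Proof.
move=> phi.
have eker A (k : K A) : hom_eq (fhom phi ((k, gid A) : @ghom (cross_product F) A A)) (ext_ker E k).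
  exact: (hom_eq_functor (ehom_incl phi A) (k : @ghom (delooping (K A)) tt tt)).
have eobj A : phi A = ext_base E A by have [] := hom_eq_ends (eker A 1).
pose c (A B : G) (u : ghom A B) : @ghom (cross_product F) A B := (1, u).
pose s (A B : G) (u : ghom A B) := projT1 (boolp.cid
  (hom_eq_cast_ex (fhom phi (c A B u)) (eobj A) (eobj B))).
have sP (A B : G) (u : ghom A B) : hom_eq (fhom phi (c A B u)) (s A B u).
  by rewrite /s; case: boolp.cid.
constructor; exists s => [A B u|A B u x|A B C v u].
- apply: hom_eq_trans (hom_eq_fhom _ (hom_eq_sym (sP _ _ u))) _.
  exact: (hom_eq_functor (ehom_proj phi) (c A B u : @ghom (cross_product F) A B)).
- apply/hom_eqP; apply: hom_eq_trans
    (hom_eq_comp (hom_eq_sym (sP _ _ u)) (hom_eq_sym (eker _ x))) _.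
  apply: hom_eq_trans (hom_eq_comp (eker _ (wact F u x)) (sP _ _ u)).
  rewrite -!fhomM /= /cross_comp /= wcoc1l wcoc1r gcomp1l gcomp1r wact1.
  by rewrite !mulg1 mul1g.
- apply/hom_eqP; apply: hom_eq_trans
    (hom_eq_comp (hom_eq_sym (sP _ _ v)) (hom_eq_sym (sP _ _ u))) _.
  apply: hom_eq_trans (hom_eq_comp (eker _ (wcoc F v u)) (sP _ _ (v \og u))).
  rewrite -!fhomM /= /cross_comp /= wcoc1l gcomp1l wact1 wact_one.
  by rewrite !mulg1 mul1g.
Qed.

(** The elements tau(u) with s'(u) = tau(u) s(u) form a morphism: each of its
axioms is checked after multiplying by s on the right, where it follows from
the rules obeyed by s and s'. *)
Lemma presents_cohomologous (F F' : weak_action K) (E : extension K) :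
  presents F E -> presents F' E -> inhabited (weak_action_hom F F').
Proof.
move=> s s'.
have tauP A B (u : ghom A B) : exists t : K B, psec s' u = ext_ker E t \og psec s u.
  exact: ext_ker_torsor (psec_proj s u) (psec_proj s' u).
pose tau A B (u : ghom A B) := projT1 (boolp.cid (tauP A B u)).
have tauE A B (u : ghom A B) : psec s' u = ext_ker E (tau A B u) \og psec s u.
  by rewrite /tau; case: boolp.cid.
constructor; exists tau => [A B u k|A|A B C v u].
- apply: (@ext_ker_cancel _ _ E _ _ (psec s u)).
  rewrite !ext_kerM -!gcompA -tauE -!psec_act.
  by rewrite gcompA -tauE.
- apply: (@ext_ker_cancel _ _ E _ _ (psec s (gid A))).
  by rewrite -tauE ext_ker1 !psec1 gcomp1l.
- apply: (@ext_ker_cancel _ _ E _ _ (psec s (v \og u))).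
  rewrite !ext_kerM -!gcompA -tauE -!psecM.
  rewrite [ext_ker E (tau _ _ v) \og _]gcompA -tauE gcompA -psec_act.
  by rewrite -gcompA -tauE.
Qed.

(** If two sections satisfy s' = tau s then s = tau^-1 s', which dictates the
section of the crossed product of F' that obeys the rules of F. *)
Lemma presents_pushforward (F F' : weak_action K) :
  weak_action_hom F F' -> presents F (cross F').
Proof.
move=> t.
exists (fun A B u => ((wtr t u)^-1, u)) => [A B u|A B u x|A B C v u].
- exact: hom_eq_refl.
- rewrite /= /cross_comp /= wcoc1l wcoc1r gcomp1l gcomp1r wact1 !mulg1.
  by congr pair; apply: (mulgI (wtr t u)); rewrite mulVKg mulgA wtr_act mulgK.
- rewrite /= /cross_comp /= wcoc1l gcomp1l wact1 mulg1 wactV; congr pair.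
  apply: (mulgI (wact F' v (wtr t u) * wtr t v)).
  by rewrite [RHS]mulgA wtr_coc mulgK -!mulgA !mulVKg.
Qed.

(** A lift provided by the fibration property ends at some object over B, which
is the base point since the projection is injective on objects. *)
Lemma ext_lift (E : extension K) (A B : G) (u : ghom A B) :
  exists t : ghom (ext_base E A) (ext_base E B), hom_eq (fhom (ext_proj E) t) u.
Proof.
have [u' eu] := hom_eq_cast_ex u (esym (ext_proj_base E A)) (erefl B).
have [Y [t et]] := ext_fibration u'.
have eY : Y = ext_base E B.
  by rewrite -(ext_base_proj Y); have [_ ->] := hom_eq_ends et.
have [t' ett'] := hom_eq_cast_ex t erefl eY.
exists t'; apply: hom_eq_trans (hom_eq_fhom _ (hom_eq_sym ett')) _.
exact: hom_eq_trans et (hom_eq_sym eu).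
Qed.

(** The identity must be lifted to the identity, as weak actions are normalized.
Stating this for an arrow u that happens to be an identity lets a section be
chosen uniformly in u. *)
Lemma ext_normalized_lift (E : extension K) (A B : G) (u : ghom A B) :
  exists t : ghom (ext_base E A) (ext_base E B),
    hom_eq (fhom (ext_proj E) t) u /\
    (hom_eq u (gid A) -> hom_eq t (gid (ext_base E A))).
Proof.
have [e|ne] := pselect (hom_eq u (gid A)); last first.
  by have [t et] := ext_lift E u; exists t; split.
have [_ eB] := hom_eq_ends e; subst B; move/hom_eqP: e => ->.
exists (gid _); split => //; rewrite fhom1.
exact: hom_eq_gid (ext_proj_base E A).
Qed.

(** The weak action read off a normalized section of an extension: F(u) is
conjugation by s(u), and sigma_{vu} compares s(v) s(u) with s(vu).  All its axioms
hold in E after multiplying by a value of s on the right. *)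
Section ExtensionCocycle.
Variables (E : extension K)
  (s : forall A B : G, ghom A B -> ghom (ext_base E A) (ext_base E B)).
Hypothesis s_proj : forall (A B : G) (u : ghom A B),
  hom_eq (fhom (ext_proj E) (s u)) u.
Hypothesis s1 : forall A : G, s (gid A) = gid (ext_base E A).

Lemma sec_conj_ex (A B : G) (u : ghom A B) (x : K A) :
  exists y : K B, s u \og ext_ker E x = ext_ker E y \og s u.
Proof.
apply: (@ext_ker_torsor _ _ _ _ _ u) => //.
by rewrite fhomM -[X in hom_eq _ X]gcomp1r; apply: hom_eq_comp (ext_proj_ker _ _).
Qed.

Definition sec_act (A B : G) (u : ghom A B) (x : K A) : K B :=
  projT1 (boolp.cid (sec_conj_ex u x)).

Lemma sec_actE (A B : G) (u : ghom A B) (x : K A) :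
  s u \og ext_ker E x = ext_ker E (sec_act u x) \og s u.
Proof. by rewrite /sec_act; case: boolp.cid. Qed.

Lemma sec_actM (A B : G) (u : ghom A B) : {morph sec_act u : x y / x * y}.
Proof.
move=> x y; apply: (@ext_ker_cancel _ _ E _ _ (s u)).
by rewrite -sec_actE !ext_kerM gcompA sec_actE -!gcompA sec_actE.
Qed.

Definition sec_mor (A B : G) (u : ghom A B) : {multiplicative K A -> K B} :=
  HB.pack_for {multiplicative K A -> K B} (sec_act u)
    (isMultiplicative.Build _ _ (sec_act u) (sec_actM u)).

Lemma sec_act_bij (A B : G) (u : ghom A B) : bijective (sec_act u).
Proof.
have invP (y : K B) : exists x : K A, sec_act u x = y.
  have [|x ex] := @ext_ker_surj _ _ E A (ginv (s u) \og (ext_ker E y \og s u)).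
    rewrite !fhomM fhomV -(gcompVl u); apply: hom_eq_comp; first exact: hom_eq_inv.
    by rewrite -[X in hom_eq _ X]gcomp1l; apply: hom_eq_comp (ext_proj_ker _ _) _.
  by exists x; apply: (@ext_ker_cancel _ _ E _ _ (s u)); rewrite -sec_actE ex gcompVVK.
exists (fun y => projT1 (boolp.cid (invP y))) => [x|y]; case: boolp.cid => //= z ez.
apply: (@ext_ker_inj _ _ E); apply: (@gcompI _ _ _ _ _ _ (s u)).
by rewrite !sec_actE ez.
Qed.

Lemma sec_coc_ex (A B C : G) (v : ghom B C) (u : ghom A B) :
  exists k : K C, s v \og s u = ext_ker E k \og s (v \og u).
Proof.
by apply: (@ext_ker_torsor _ _ _ _ _ (v \og u)) => //; rewrite fhomM; apply: hom_eq_comp.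
Qed.

Definition sec_coc (A B C : G) (v : ghom B C) (u : ghom A B) : K C :=
  projT1 (boolp.cid (sec_coc_ex v u)).

Lemma sec_cocE (A B C : G) (v : ghom B C) (u : ghom A B) :
  s v \og s u = ext_ker E (sec_coc v u) \og s (v \og u).
Proof. by rewrite /sec_coc; case: boolp.cid. Qed.

Definition sec_weak_action : weak_action K.
Proof.
refine (@WeakAction G K sec_mor sec_act_bij sec_coc _ _ _ _) => /=.
- move=> A x; apply: (@ext_ker_cancel _ _ E _ _ (s (gid A))).
  by rewrite -sec_actE s1 gcomp1l gcomp1r.
- move=> A; apply: (@ext_ker_cancel _ _ E _ _ (s (gid A \og gid A))).
  by rewrite -sec_cocE !gcomp1l ext_ker1 s1 gcomp1l.
- move=> A B C v u x; apply: (@ext_ker_cancel _ _ E _ _ (s (v \og u))).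
  rewrite !ext_kerM -!gcompA -sec_actE -sec_cocE gcompA -sec_cocE.
  by rewrite -gcompA sec_actE gcompA sec_actE -!gcompA.
- move=> A B C D w v u; apply: (@ext_ker_cancel _ _ E _ _ (s (w \og v \og u))).
  rewrite !ext_kerM -!gcompA -(sec_cocE w) [in RHS]gcompA -sec_actE.
  rewrite -[in RHS]gcompA -(sec_cocE v) [w \og (v \og u)]gcompA -sec_cocE.
  by rewrite gcompA -sec_cocE gcompA.
Defined.

Definition sec_presents : presents sec_weak_action E :=
  @Presents sec_weak_action E s s_proj sec_actE sec_cocE.

End ExtensionCocycle.

Lemma presents_ex (E : extension K) : exists F, inhabited (presents F E).
Proof.
pose s A B (u : ghom A B) := projT1 (boolp.cid (ext_normalized_lift E u)).
have sP A B (u : ghom A B) : hom_eq (fhom (ext_proj E) (s A B u)) u.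
  by rewrite /s; case: boolp.cid => t /= [].
have s1 A : s A A (gid A) = gid (ext_base E A).
  by apply/hom_eqP; rewrite /s; case: boolp.cid => t /= [_]; apply; exact: hom_eq_refl.
by eexists; constructor; exact: sec_presents sP s1.
Qed.

End Presentation.

(** * Connected components *)

Lemma connected_eq (C : category) (X Y : C) :
  connected X Y -> connected X = connected Y.
Proof.
move=> XY; apply/funext => Z; apply/propext; split; last exact: rst_trans.
exact: rst_trans (rst_sym _ _ _ _ XY).
Qed.

Lemma connected_components_bij (C D : category) (f : C -> D) :
  (forall X Y : C, connected (f X) (f Y) <-> connected X Y) ->
  (forall Z : D, exists X : C, connected (f X) Z) ->
  exists g : connected_components C -> connected_components D, bijective g.
Proof.
move=> ff fs.
pose cls (B : category) (X : B) : connected_components B :=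
  exist _ (connected X) (ex_intro _ X erefl).
have clsE (B : category) (X Y : B) : cls B X = cls B Y <-> connected X Y.
  split=> [/(congr1 sval) /= ->|XY]; first exact: rst_refl.
  by apply: eq_exist; exact: connected_eq.
have repP (B : category) (S : connected_components B) : exists X, S = cls B X.
  by case: S => S [X eX]; exists X; apply: eq_exist.
pose rep (B : category) (S : connected_components B) := projT1 (boolp.cid (repP B S)).
have repE (B : category) (S : connected_components B) : cls B (rep B S) = S.
  by rewrite /rep; case: boolp.cid => X /= ->.
pose lift (Z : D) := projT1 (boolp.cid (fs Z)).
have liftP (Z : D) : connected (f (lift Z)) Z by rewrite /lift; case: boolp.cid.
exists (fun S => cls D (f (rep C S))); exists (fun T => cls C (lift (rep D T))) => S.
- rewrite -[RHS]repE; apply/clsE/ff; apply: rst_trans (liftP _) _.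
  by apply/clsE; rewrite repE.
- rewrite -[RHS]repE; apply/clsE; apply: rst_trans (liftP _).
  by apply/ff/clsE; rewrite repE.
Qed.

(** * The bijection *)

Section Classification.
Variables (G : groupoid) (K : G -> groupType).

Lemma cross_connected (F F' : Act K) :
  connected F F' -> connected (cross F : Ext K) (cross F').
Proof.
elim=> [{}F {}F' [t]|{}F|{}F {}F' _|{}F F'' {}F' _ + _].
- by apply: rst_step; constructor; exact: presents_hom (presents_pushforward t).
- exact: rst_refl.
- exact: rst_sym.
- exact: rst_trans.
Qed.

(** The zigzag between E and E' may run through arbitrary extensions, so the
induction is on extensions, each being replaced by a weak action that
presents it. *)
Lemma presents_connected (E E' : Ext K) :
  connected E E' -> forall F F' : Act K,
  inhabited (presents F E) -> inhabited (presents F' E') -> connected F F'.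
Proof.
elim=> [{}E {}E' [phi]|{}E|{}E {}E' _ IH|{}E E'' {}E' _ IH _ IH'] F F' sF sF'.
- case: sF sF' => s [s'].
  have [s''] := presents_of_hom (extension_comp phi (presents_hom s)).
  by apply: rst_step; exact: presents_cohomologous s'' s'.
- by case: sF sF' => s [s']; apply: rst_step; exact: presents_cohomologous s s'.
- by apply: rst_sym; exact: IH.
- have [F'' sF''] := presents_ex E''.
  exact: rst_trans (IH _ _ sF sF'') (IH' _ _ sF'' sF').
Qed.

End Classification.

Theorem corollary3p4 (G : groupoid) (K : G -> groupType) :
  exists f : H2_AUT K -> Ext_components K, bijective f.
Proof.
apply: (@connected_components_bij (Act K) (Ext K) (@cross G K)).
- move=> F F'; split; last exact: cross_connected.
  move=> e; apply: presents_connected e _ _ _ _;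
    exact: presents_of_hom (extension_id _).
- move=> E; have [F [s]] := presents_ex E.
  by exists F; apply: rst_step; constructor; exact: presents_hom s.
Qed.
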